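(* Let $N,k\ge1$ and $p\ge0$ be integers and $L=kN+p$. Let $(\eta^{ij})$ ($N\times N$), $(c^{\sigma\tau})$ ($k\times k$), $(\mu^{\alpha\beta})$ ($L\times L$) be constant nondegenerate symmetric real matrices with $$\mu^{(\sigma-1)N+m,\,(\tau-1)N+n}=c^{\sigma\tau}\eta^{mn},\qquad 1\le\sigma,\tau\le k,\ 1\le m,n\le N,$$ the remaining entries of $\mu$ being arbitrary subject to symmetry and nondegeneracy. Let $\Phi(u^1,\dots,u^N)$ be a smooth function on an open set of $\mathbb{R}^N$. Put $\psi_{(\sigma-1)N+i}=\partial\Phi/\partial u^i$ for $1\le\sigma\le k$, $1\le i\le N$, and let $\psi_\alpha$ for $kN+1\le\alpha\le L$ be arbitrary functions linear in the coordinates $u^1,\dots,u^N$. Then the associativity equations for $\Phi$ are a ($k$-potential) reduction of the fundamental equations of submanifold theory in the following sense. For the first fundamental form $g_{ij}=\eta_{ij}$, the normal Gram matrix $h_{\alpha\beta}=\mu_{\alpha\beta}$, zero torsion forms $\varkappa_{\alpha\beta i}=0$, and the second fundamental forms $\omega_{\alpha ij}=\partial^2\psi_\alpha/\partial u^i\partial u^j$ ($1\le\alpha\le L$), the whole system of fundamental relations (the compatibility relation of Gram matrix and torsion together with the Gauss, Codazzi and Ricci equations) for $N$-dimensional submanifolds in $((k+1)N+p)$-dimensional pseudo-Euclidean spaces holds if and only if $\Phi$ satisfies the associativity equations $$\sum_{a,b=1}^N\frac{\partial^3\Phi}{\partial u^i\partial u^j\partial u^a}\eta^{ab}\frac{\partial^3\Phi}{\partial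 u^b\partial u^m\partial u^n}=\sum_{a,b=1}^N\frac{\partial^3\Phi}{\partial u^i\partial u^m\partial u^a}\eta^{ab}\frac{\partial^3\Phi}{\partial u^b\partial u^j\partial u^n},\qquad 1\le i,j,m,n\le N.$$
   Context: $(\eta_{ij})$ and $(\mu_{\alpha\beta})$ denote the inverses of $(\eta^{ij})$ and $(\mu^{\alpha\beta})$. Summation over repeated indices is understood below. **Fundamental relations.** Consider a submanifold $r(u^1,\dots,u^N)$ in an $(N+L)$-dimensional pseudo-Euclidean space with nondegenerate first fundamental form $g_{ij}=(\partial_i r,\partial_j r)$ and arbitrary smooth basis $n_1,\dots,n_L$ of the normal spaces. Set $h_{\alpha\beta}=(n_\alpha,n_\beta)$ (Gram matrix), $\omega_{\alpha ij}=(\partial_i\partial_j r,n_\alpha)$ (second fundamental forms), and $\varkappa_{\alpha\beta i}=(\partial_i n_\alpha,n_\beta)$ (torsion forms). Define coefficients by $\omega_{\alpha ij}=b^\beta_{ij}h_{\beta\alpha}$, $c^l_{\alpha i}=-g^{ls}\omega_{\alpha si}$, $\varkappa_{\alpha\beta i}=d^\gamma_{\alpha i}h_{\gamma\beta}$. The fundamental relations for prescribed $g,h,\omega,\varkappa$ (with $g$, $h$ and each $\omega_\alpha$ symmetric) are: - $\varkappa_{\alpha\beta i}+\varkappa_{\beta\alpha i}=\partial_i h_{\alpha\beta}$; - Gauss: $\partial_s\Gamma^l_{ij}-\partial_j\Gamma^l_{is}+\Gamma^a_{ij}\Gamma^l_{as}-\Gamma^a_{is}\Gamma^l_{aj}=b^\gamma_{is}c^l_{\gamma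 j}-b^\gamma_{ij}c^l_{\gamma s}$, with $\Gamma$ the Christoffel symbols of $g$; - Codazzi: $\Gamma^l_{ij}b^\beta_{ls}+\partial_s b^\beta_{ij}+b^\gamma_{ij}d^\beta_{\gamma s}=\Gamma^l_{is}b^\beta_{lj}+\partial_j b^\beta_{is}+b^\gamma_{is}d^\beta_{\gamma j}$; - Ricci: $c^l_{\alpha j}b^\beta_{ls}+\partial_s d^\beta_{\alpha j}+d^\gamma_{\alpha j}d^\beta_{\gamma s}=c^l_{\alpha s}b^\beta_{lj}+\partial_j d^\beta_{\alpha s}+d^\gamma_{\alpha s}d^\beta_{\gamma j}$. *)

(* Defs.v *)
From HB Require Import structures.
From mathcomp Require Import all_boot all_order all_algebra.
From mathcomp Require Import all_classical all_reals all_analysis.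

Set Implicit Arguments.
Unset Strict Implicit.
Unset Printing Implicit Defensive.
Import Order.TTheory GRing.Theory Num.Theory.
Import numFieldNormedType.Exports.

Local Open Scope classical_set_scope.
Local Open Scope ring_scope.

(* Points of R^N are row vectors, indices are 0-based.  Fields are total
   functions on R^N, and only their restriction to an open set U matters. *)

Section PartialDerivatives.
Variables (R : realType) (N : nat).
Implicit Types (f : 'rV[R]_N -> R) (U : set 'rV[R]_N).

Definition partial (i : 'I_N) f : 'rV[R]_N -> R :=
  fun u => 'D_(delta_mx 0 i) f u.

Definition iter_partial (s : seq 'I_N) f : 'rV[R]_N -> R := foldr partial f s.

(* Since 'D_v f is a total function, existence of the derivatives has to be
   required separately from their continuity. *)
Definition smooth_on U f : Prop :=
  forall (s : seq 'I_N) (u : 'rV[R]_N), U u ->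
    {for u, continuous (iter_partial s f)} /\
    forall i : 'I_N, derivable (iter_partial s f) u (delta_mx 0 i).

Definition affine_on U f : Prop :=
  exists (a : 'I_N -> R) (b : R), forall u, U u -> f u = b + \sum_i a i * u 0 i.

End PartialDerivatives.

Section FundamentalRelations.
Variables (R : realType) (N L : nat).
Variable g : 'rV[R]_N -> 'M[R]_N.
Variable h : 'rV[R]_N -> 'M[R]_L.
Variable omega : 'I_L -> 'I_N -> 'I_N -> 'rV[R]_N -> R.
Variable kappa : 'I_L -> 'I_L -> 'I_N -> 'rV[R]_N -> R.

Definition symmetric_nondegenerate n (A : 'M[R]_n) : Prop :=
  A^T = A /\ A \in unitmx.

Definition admissible (U : set 'rV[R]_N) : Prop := forall u, U u ->
  [/\ symmetric_nondegenerate (g u),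
      symmetric_nondegenerate (h u)
    & forall alpha i j, omega alpha i j u = omega alpha j i u].

(* christoffel l i j is Gamma^l_{ij} of the metric g. *)
Definition christoffel (l i j : 'I_N) (u : 'rV[R]_N) : R :=
  2^-1 * \sum_(s < N) invmx (g u) l s *
    (partial i (fun v => g v s j) u + partial j (fun v => g v s i) u
     - partial s (fun v => g v i j) u).

(* bcoef beta i j is b^beta_{ij}, ccoef l alpha i is c^l_{alpha i} and
   dcoef gamma alpha i is d^gamma_{alpha i}; b and d are obtained by solving
   their defining equations for nondegenerate h, see bcoefP and dcoefP. *)
Definition bcoef (beta : 'I_L) (i j : 'I_N) (u : 'rV[R]_N) : R :=
  \sum_(alpha < L) omega alpha i j u * invmx (h u) alpha beta.

Definition ccoef (l : 'I_N) (alpha : 'I_L) (i : 'I_N) (u : 'rV[R]_N) : R :=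
  - \sum_(s < N) invmx (g u) l s * omega alpha s i u.

Definition dcoef (gamma alpha : 'I_L) (i : 'I_N) (u : 'rV[R]_N) : R :=
  \sum_(beta < L) kappa alpha beta i u * invmx (h u) beta gamma.

Lemma bcoefP (alpha : 'I_L) (i j : 'I_N) (u : 'rV[R]_N) : h u \in unitmx ->
  omega alpha i j u = \sum_(beta < L) bcoef beta i j u * h u beta alpha.
Proof.
move=> hu; pose w : 'rV_L := \row_a omega a i j u.
have -> : omega alpha i j u = (w *m invmx (h u) *m h u) 0 alpha.
  by rewrite mulmxKV// mxE.
rewrite mxE; apply: eq_bigr => b _; rewrite mxE; congr (_ * _).
by apply: eq_bigr => a _; rewrite mxE.
Qed.

Lemma dcoefP (alpha beta : 'I_L) (i : 'I_N) (u : 'rV[R]_N) : h u \in unitmx ->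
  kappa alpha beta i u = \sum_(gamma < L) dcoef gamma alpha i u * h u gamma beta.
Proof.
move=> hu; pose w : 'rV_L := \row_a kappa alpha a i u.
have -> : kappa alpha beta i u = (w *m invmx (h u) *m h u) 0 beta.
  by rewrite mulmxKV// mxE.
rewrite mxE; apply: eq_bigr => c _; rewrite mxE; congr (_ * _).
by apply: eq_bigr => a _; rewrite mxE.
Qed.

Definition gram_torsion_compatibility (u : 'rV[R]_N) : Prop :=
  forall (alpha beta : 'I_L) (i : 'I_N),
    kappa alpha beta i u + kappa beta alpha i u
    = partial i (fun v => h v alpha beta) u.

Definition gauss_equation (u : 'rV[R]_N) : Prop := forall l i j s : 'I_N,
  partial s (christoffel l i j) u - partial j (christoffel l i s) u
  + \sum_(a < N) christoffel a i j u * christoffel l a s u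
  - \sum_(a < N) christoffel a i s u * christoffel l a j u
  = \sum_(gamma < L) bcoef gamma i s u * ccoef l gamma j u
    - \sum_(gamma < L) bcoef gamma i j u * ccoef l gamma s u.

Definition codazzi_equation (u : 'rV[R]_N) : Prop :=
  forall (beta : 'I_L) (i j s : 'I_N),
  \sum_(l < N) christoffel l i j u * bcoef beta l s u
  + partial s (bcoef beta i j) u
  + \sum_(gamma < L) bcoef gamma i j u * dcoef beta gamma s u
  = \sum_(l < N) christoffel l i s u * bcoef beta l j u
    + partial j (bcoef beta i s) u
    + \sum_(gamma < L) bcoef gamma i s u * dcoef beta gamma j u.

Definition ricci_equation (u : 'rV[R]_N) : Prop :=
  forall (alpha beta : 'I_L) (j s : 'I_N),
  \sum_(l < N) ccoef l alpha j u * bcoef beta l s u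
  + partial s (dcoef beta alpha j) u
  + \sum_(gamma < L) dcoef gamma alpha j u * dcoef beta gamma s u
  = \sum_(l < N) ccoef l alpha s u * bcoef beta l j u
    + partial j (dcoef beta alpha s) u
    + \sum_(gamma < L) dcoef gamma alpha s u * dcoef beta gamma j u.

Definition fundamental_relations (U : set 'rV[R]_N) : Prop := forall u, U u ->
  [/\ gram_torsion_compatibility u, gauss_equation u,
      codazzi_equation u & ricci_equation u].

End FundamentalRelations.

Definition associativity_equations (R : realType) (N : nat) (eta : 'M[R]_N)
    (Phi : 'rV[R]_N -> R) (U : set 'rV[R]_N) : Prop :=
  forall u, U u -> forall i j m n : 'I_N,
  \sum_(a < N) \sum_(b < N) partial i (partial j (partial a Phi)) u
    * eta a b * partial b (partial m (partial n Phi)) u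
  = \sum_(a < N) \sum_(b < N) partial i (partial m (partial a Phi)) u
    * eta a b * partial b (partial j (partial n Phi)) u.

Lemma block_index_subproof (k N p : nat) (sigma : 'I_k) (i : 'I_N) :
  (sigma * N + i < k * N + p)%N.
Proof.
apply: (@leq_trans (sigma.+1 * N)%N).
  by rewrite mulSn addnC ltn_add2r.
by apply: leq_trans (leq_addr _ _); rewrite leq_mul2r ltn_ord orbT.
Qed.

(* The 0-based form of the index (sigma - 1) N + i.  The remaining p indices
   are rshift (k * N) q for q : 'I_p. *)
Definition block_index (k N p : nat) (sigma : 'I_k) (i : 'I_N) :
  'I_(k * N + p) := Ordinal (block_index_subproof p sigma i).

(* Main.v *)
(** Every [psi alpha] is either a first partial of [Phi] or affine.  With constant Gram matrices and zero torsion the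
Christoffel symbols and [d] vanish, so Codazzi is the symmetry of third
partials.  Multiplying by the inverse of [mu], Ricci says that the contraction
[eta^(lt) omega_(alpha t j) omega_(gamma l s)] is symmetric in [j] and [s]: for
block indices this is associativity (hence the converse, as [1 <= k]), and
otherwise both sides are 0.  In Gauss, the block form of [mu] factors the
contraction over normal indices as [sum_(s,t) c^(st)] times the associativity
expression. *)
Require Import Defs.
From mathcomp Require Import all_boot all_order all_algebra.
From mathcomp Require Import all_classical all_reals all_analysis.
From mathcomp Require Import ring.
Import Order.TTheory GRing.Theory Num.Theory.
Import numFieldNormedType.Exports.

Set Implicit Arguments.
Unset Strict Implicit.
Unset Printing Implicit Defensive.

Local Open Scope classical_set_scope.
Local Open Scope ring_scope.

(** * Mean value theorem and symmetry of mixed directional derivatives *)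

Lemma MVT_closed (R : realType) (f df : R -> R) (a b : R) : a < b ->
  (forall x, a <= x <= b -> is_derive x 1 f (df x)) ->
  exists2 c, a <= c <= b & f b - f a = df c * (b - a).
Proof.
move=> ab fdf.
have fab : {within `[a, b], continuous f}.
  apply: derivable_within_continuous => x; rewrite in_itv/= => xab.
  by have [] := fdf x xab.
have dab x : x \in `]a, b[ -> is_derive x 1 f (df x).
  by rewrite in_itv/= => /andP[ax xb]; apply: fdf; rewrite !ltW.
have [c cab E] := MVT ab dab fab; exists c => //.
by move: cab; rewrite in_itv/= => /andP[ac cb]; rewrite !ltW.
Qed.

Lemma ler_dist_half (R : realFieldType) (x y z e : R) :
  `|x - z| < e / 2 -> `|y - z| < e / 2 -> `|x - y| <= e.
Proof.
move=> xz yz; rewrite (le_trans (ler_distD z _ _))// [leRHS]splitr.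
by rewrite (distrC z) ltW// ltrD.
Qed.

Section Schwarz.
Variables (R : realType) (V : normedModType R).
Implicit Types (f : V -> R) (u v w : V).

(** The difference quotient of the restriction to the line, taken at [t], is literally that of [f]
    at [t *: v + u] in the direction [v]. *)
Lemma is_derive_line f u v (t : R) : derivable f (t *: v + u) v ->
  is_derive t 1 (fun s => f (s *: v + u)) ('D_v f (t *: v + u)).
Proof.
have E : (fun h : R => h^-1 *: (((fun s => f (s *: v + u)) \o shift t) (h *: 1)
                          - f (t *: v + u)))
       = (fun h => h^-1 *: ((f \o shift (t *: v + u)) (h *: v)
                            - f (t *: v + u))).
  apply/funext => h /=; congr (_ *: (f _ - _)).
  by rewrite [h *: 1]mulr1 scalerDl addrA.
move=> df; apply: DeriveDef; first by rewrite /derivable E.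
by rewrite /derive E.
Qed.

(* The mean value theorem is applied first in the direction [v], then in the
   direction [w]. *)
Lemma mixed_difference f u v w (h : R) : 0 < h ->
  (forall s t, 0 <= s <= h -> 0 <= t <= h ->
     derivable f (s *: v + (t *: w + u)) v /\
     derivable ('D_v f) (s *: v + (t *: w + u)) w) ->
  exists s t, [/\ 0 <= s <= h, 0 <= t <= h &
    f (h *: v + (h *: w + u)) - f (h *: v + u) - f (h *: w + u) + f u
    = h ^+ 2 * 'D_w ('D_v f) (s *: v + (t *: w + u))].
Proof.
move=> h0 df; have hh : 0 <= h <= h by rewrite (ltW h0) lexx.
have zh : 0 <= (0 : R) <= h by rewrite (ltW h0) lexx.
(* [phi h - phi 0] is the mixed second difference; the vanishing term [0 *: w] is kept so that both
   points have the shape required by [df]. *)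
pose phi s := f (s *: v + (h *: w + u)) - f (s *: v + (0 *: w + u)).
pose dphi s := 'D_v f (s *: v + (h *: w + u)) - 'D_v f (s *: v + (0 *: w + u)).
have dphiP s : 0 <= s <= h -> is_derive s 1 phi (dphi s).
  move=> sh; have [d1 _] := df _ _ sh hh; have [d2 _] := df _ _ sh zh.
  exact: (@is_deriveB _ _ _ _ _ _ _ _ _ (is_derive_line d1) (is_derive_line d2)).
have [s sh phiE] : exists2 s, 0 <= s <= h & phi h - phi 0 = dphi s * (h - 0).
  by apply: MVT_closed.
pose psi t := 'D_v f (t *: w + (s *: v + u)).
pose dpsi t := 'D_w ('D_v f) (t *: w + (s *: v + u)).
have dpsiP t : 0 <= t <= h -> is_derive t 1 psi (dpsi t).
  move=> th; have [_] := df _ _ sh th.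
  by rewrite addrCA; exact: is_derive_line.
have [t th psiE] : exists2 t, 0 <= t <= h & psi h - psi 0 = dpsi t * (h - 0).
  by apply: MVT_closed.
exists s, t; split => //.
have -> : 'D_w ('D_v f) (s *: v + (t *: w + u)) = dpsi t by rewrite /dpsi addrCA.
have -> : h ^+ 2 * dpsi t = dphi s * h.
  rewrite expr2 -mulrA mulrC; congr (_ * _).
  by move: psiE; rewrite subr0 mulrC => <-; rewrite /psi /dphi
    ![_ + (s *: v + _)]addrCA.
by move: phiE; rewrite subr0 => <-; rewrite /phi !scale0r !add0r; ring.
Qed.

(** The mixed second difference is symmetric in [v] and [w], so [mixed_difference] equates the two
    mixed derivatives at two points near [u]. By continuity each is then within [e / 2] of its value
    at [u], for arbitrary [e]. *)
Lemma schwarz f u v w :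
  (\forall x \near u, [/\ derivable f x v, derivable f x w,
     derivable ('D_v f) x w & derivable ('D_w f) x v]) ->
  {for u, continuous ('D_w ('D_v f))} -> {for u, continuous ('D_v ('D_w f))} ->
  'D_w ('D_v f) u = 'D_v ('D_w f) u.
Proof.
move=> df cwv cvw; apply/eqP; rewrite -subr_eq0 -normr_le0.
apply/ler_addgt0Pl => e e0; rewrite addr0.
have e2 : 0 < e / 2 by rewrite divr_gt0.
have Nu : \forall x \near u, [/\ [/\ derivable f x v, derivable f x w,
     derivable ('D_v f) x w & derivable ('D_w f) x v],
     `|'D_w ('D_v f) u - 'D_w ('D_v f) x| < e / 2 &
     `|'D_v ('D_w f) u - 'D_v ('D_w f) x| < e / 2].
  have W : \forall x \near u, `|'D_w ('D_v f) u - 'D_w ('D_v f) x| < e / 2.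
    exact: ((@cvgrPdist_lt _ _ _ _ _ _ _).1 cwv _ e2).
  have W' : \forall x \near u, `|'D_v ('D_w f) u - 'D_v ('D_w f) x| < e / 2.
    exact: ((@cvgrPdist_lt _ _ _ _ _ _ _).1 cvw _ e2).
  exact: (filterS3 _ (fun x a b c => And3 a b c) df W W').
have [d /= d0 Pd] := (nbhs_normP _ _).1 Nu.
(* The summand 1 keeps [D] positive even for [v = w = 0], and makes the parallelogram of side
   parameter [d / D] lie strictly within distance [d] of [u]. *)
pose D := `|v| + `|w| + 1; have D0 : 0 < D by rewrite ltr_wpDl// addr_ge0.
pose h := d / D; have h0 : 0 < h by rewrite divr_gt0.
have in_d s t : 0 <= s <= h -> 0 <= t <= h ->
    `|u - (s *: v + (t *: w + u))| < d.
  move=> /andP[s0 sh] /andP[t0 th].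
  rewrite distrC addrA addrK (le_lt_trans (ler_normD _ _))// !normrZ.
  rewrite !ger0_norm// (@le_lt_trans _ _ (h * (`|v| + `|w|)))//.
    by rewrite mulrDr lerD// ler_wpM2r.
  by rewrite -[ltRHS](divfK (lt0r_neq0 D0)) -/h ltr_pM2l// ltrDl.
have [|s [t [sh th E1]]] := @mixed_difference f u v w h h0.
  by move=> s t sh th; have [[? _ ? _] _ _] := Pd _ (in_d _ _ sh th).
have [|t' [s' [th' sh' E2]]] := @mixed_difference f u w v h h0.
  move=> t0 s0 th0 sh0; rewrite addrCA.
  by have [[_ ? _ ?] _ _] := Pd _ (in_d _ _ sh0 th0).
have [_ Ds _] := Pd _ (in_d _ _ sh th).
have [_ _ Ds'] := Pd _ (in_d _ _ sh' th').
(* [E1] and [E2] evaluate the same second difference, up to the order of its terms; [h ^+ 2]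
   cancels. *)
have E : 'D_w ('D_v f) (s *: v + (t *: w + u))
       = 'D_v ('D_w f) (s' *: v + (t' *: w + u)).
  apply: (@mulfI _ (h ^+ 2)); first by rewrite sqrf_eq0 gt_eqF.
  rewrite [t' *: w + _]addrCA [h *: w + (h *: v + _)]addrCA in E2.
  by apply: etrans (esym E1) (etrans _ E2); ring.
rewrite E in Ds; exact: ler_dist_half Ds Ds'.
Qed.

End Schwarz.

(** * Partial derivatives of smooth and affine functions on an open set *)

Section SmoothFunctions.
Variables (R : realType) (N : nat) (U : set 'rV[R]_N).
Hypothesis U_open : open U.
Implicit Types f : 'rV[R]_N -> R.

Lemma near_eq_on f f' (u : 'rV[R]_N) :
  (forall x, U x -> f x = f' x) -> U u -> \forall x \near u, f x = f' x.
Proof. by move=> ff' Uu; apply: filterS ff' (open_nbhs_nbhs (conj U_open Uu)). Qed.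

Lemma eq_partial f f' (i : 'I_N) :
  (forall x, U x -> f x = f' x) ->
  forall x, U x -> partial i f x = partial i f' x.
Proof. by move=> ff' x Ux; apply: near_eq_derive; exact: near_eq_on. Qed.

(** As [U] is open, every iterated partial on [U] depends only on the values on [U], by induction on
    the index sequence. *)
Lemma eq_smooth_on f f' :
  (forall x, U x -> f x = f' x) -> smooth_on U f -> smooth_on U f'.
Proof.
move=> ff' sf s u Uu; have [cf df] := sf s u Uu.
have ffs x : U x -> iter_partial s f x = iter_partial s f' x.
  by elim: s {cf df} x => [|i s IH] //=; exact: eq_partial.
have nf := near_eq_on ffs Uu; split=> [|i]; last exact: near_eq_derivable (df i).
have cf' : iter_partial s f x @[x --> u] --> iter_partial s f' u by rewrite -ffs.
exact: cvg_trans (near_eq_cvg nf) cf'.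
Qed.

Lemma smooth_on_partial f (i : 'I_N) : smooth_on U f -> smooth_on U (partial i f).
Proof.
(* [foldr] applies the last index of the sequence first. *)
move=> sf s u Uu; have [] := sf (rcons s i) u Uu.
by rewrite /iter_partial foldr_rcons.
Qed.

Lemma smooth_on_derivable f (i : 'I_N) u :
  smooth_on U f -> U u -> derivable f u (delta_mx 0 i).
Proof. by move=> sf /(sf [::]) []. Qed.

Lemma partialC f (i j : 'I_N) u : smooth_on U f -> U u ->
  partial i (partial j f) u = partial j (partial i f) u.
Proof.
move=> sf Uu; apply: schwarz.
- apply: filterS (open_nbhs_nbhs (conj U_open Uu)) => x Ux.
  by split; apply: smooth_on_derivable Ux; do ?exact: smooth_on_partial.
- by have [] := sf [:: i; j] u Uu.
- by have [] := sf [:: j; i] u Uu.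
Qed.

(** The difference quotient is constant for nonzero increments. *)
Lemma is_derive_affine (a : 'I_N -> R) (b : R) (u v : 'rV[R]_N) :
  is_derive u v (fun x : 'rV[R]_N => b + \sum_i a i * x 0 i) (\sum_i a i * v 0 i).
Proof.
have D : (fun h => h^-1 *: (((fun x : 'rV[R]_N => b + \sum_i a i * x 0 i)
      \o shift u) (h *: v) - (b + \sum_i a i * u 0 i))) @ 0^'
    --> (\sum_i a i * v 0 i : R).
  apply: cvg_near_cst; near=> h => /=.
  have h0 : h != 0 by near: h; exact: nbhs_dnbhs_neq.
  rewrite opprD addrACA subrr add0r -sumrB.
  rewrite (eq_bigr (fun i => h * (a i * v 0 i))) => [|i _].
    by rewrite -mulr_sumr /GRing.scale/= mulKf.
  by rewrite !mxE; ring.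
by apply: DeriveDef; [apply/cvg_ex; eexists; exact: D|exact: cvg_lim D].
Unshelve. all: by end_near. Qed.

Lemma partial_affine f (a : 'I_N -> R) (b : R) :
  (forall u, U u -> f u = b + \sum_i a i * u 0 i) ->
  forall i u, U u -> partial i f u = a i.
Proof.
move=> fE i u Uu.
rewrite (eq_partial i fE Uu) /partial.
have [_ ->] := is_derive_affine a b u (delta_mx 0 i).
rewrite (bigD1 i)//= mxE !eqxx mulr1 big1 ?addr0// => j ji.
by rewrite mxE (negbTE ji) andbF mulr0.
Qed.

Lemma affine_on_partial f (i : 'I_N) : affine_on U f -> affine_on U (partial i f).
Proof.
move=> [a [b fE]]; exists (fun=> 0), (a i) => u Uu.
by rewrite (partial_affine fE i Uu) big1 ?addr0// => j _; rewrite mul0r.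
Qed.

(** Affine functions are closed under partials, so only continuity and derivability of a single
    affine function have to be checked. *)
Lemma affine_smooth_on f : affine_on U f -> smooth_on U f.
Proof.
move=> af s u Uu; have [a [b fE]] : affine_on U (iter_partial s f).
  by elim: s => //= i s; exact: affine_on_partial.
have nfE := near_eq_on (fun x Ux => esym (fE x Ux)) Uu.
split=> [|i]; last first.
  apply: near_eq_derivable nfE _.
  by have [] := is_derive_affine a b u (delta_mx 0 i).
suff cf : (b + \sum_i a i * x 0 i) @[x --> u] --> iter_partial s f u.
  exact: cvg_trans (near_eq_cvg nfE) cf.
rewrite fE//.
apply: cvgD; first exact: cvg_cst.
apply: cvg_big => [|i _]; first exact: add_continuous.
by apply: cvgM; [exact: cvg_cst|exact: coord_continuous].
Qed.

Lemma affine_on_partial2 f (i j : 'I_N) u :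
  affine_on U f -> U u -> partial i (partial j f) u = 0.
Proof.
move=> [a [b fE]] Uu.
by rewrite (eq_partial i (partial_affine fE j) Uu) /partial derive_cst.
Qed.

End SmoothFunctions.

(** * Fundamental relations for constant Gram matrices and zero torsion *)

Section ConstantCoefficients.
Variables (R : realType) (N L : nat).

Lemma partial_cst (i : 'I_N) (a : R) u : partial i (fun=> a) u = 0.
Proof. exact: derive_cst. Qed.

(** For constant [h], [bcoef] is such a combination of second fundamental forms; this is how the
    Codazzi equation gets differentiated termwise. *)
Lemma partial_lin_comb (F : 'I_L -> 'rV[R]_N -> R) (a : 'I_L -> R) i u :
  (forall alpha, derivable (F alpha) u (delta_mx 0 i)) ->
  partial i (fun v => \sum_alpha F alpha v * a alpha) u
  = \sum_alpha partial i (F alpha) u * a alpha.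
Proof.
move=> dF; rewrite /partial.
have -> : (fun v => \sum_alpha F alpha v * a alpha)
        = \sum_alpha (a alpha \*: F alpha).
  apply/funext => v; rewrite fct_sumE; apply: eq_bigr => alpha _.
  by rewrite mulrC.
rewrite derive_sum => [|alpha]; last exact: derivableZ.
by apply: eq_bigr => alpha _; rewrite deriveZ// mulrC.
Qed.

Variables (A : 'M[R]_N) (B : 'M[R]_L).
Variable omega : 'I_L -> 'I_N -> 'I_N -> 'rV[R]_N -> R.
Let b := bcoef (fun=> B) omega.
Let c := ccoef (fun=> A) omega.

Lemma christoffel_cst l i j : christoffel (fun=> A) l i j = fun=> 0.
Proof.
apply/funext => u; rewrite /christoffel big1 ?mulr0// => s _.
by rewrite !partial_cst addr0 subr0 mulr0.
Qed.

Lemma dcoef0 (h : 'rV[R]_N -> 'M[R]_L) gamma alpha (i : 'I_N) :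
  dcoef h (fun _ _ _ _ => 0) gamma alpha i = fun=> 0.
Proof.
by apply/funext => u; rewrite /dcoef big1// => beta _; rewrite mul0r.
Qed.

Lemma christoffel_cst_sum (F : 'I_N -> R) i j u :
  \sum_l christoffel (fun=> A) l i j u * F l = 0.
Proof. by rewrite big1// => l _; rewrite christoffel_cst mul0r. Qed.

Lemma dcoef0_sum (h : 'rV[R]_N -> 'M[R]_L) (F : 'I_L -> R) beta (s : 'I_N) u :
  \sum_gamma F gamma * dcoef h (fun _ _ _ _ => 0) beta gamma s u = 0.
Proof. by rewrite big1// => gamma _; rewrite dcoef0 mulr0. Qed.

(** The curvature side vanishes with the Christoffel symbols, which leaves the equality of the two
    quadratic terms. *)
Lemma cst_gauss_equation u :
  gauss_equation (fun=> A) (fun=> B) omega u <->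
  forall l i j s, \sum_gamma b gamma i s u * c l gamma j u
                  = \sum_gamma b gamma i j u * c l gamma s u.
Proof.
split=> H l i j s; have := H l i j s;
  rewrite !christoffel_cst_sum !christoffel_cst !partial_cst subrr addr0 subr0.
  by move/esym/eqP; rewrite subr_eq0 => /eqP.
by move=> E; apply/esym/eqP; rewrite subr_eq0; apply/eqP.
Qed.

Lemma cst_codazzi_equation u :
  codazzi_equation (fun=> A) (fun=> B) omega (fun _ _ _ _ => 0) u <->
  forall beta i j s, partial s (b beta i j) u = partial j (b beta i s) u.
Proof.
by split=> H beta i j s; have := H beta i j s;
  rewrite !christoffel_cst_sum !dcoef0_sum !add0r !addr0.
Qed.

Lemma cst_ricci_equation u :
  ricci_equation (fun=> A) (fun=> B) omega (fun _ _ _ _ => 0) u <->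
  forall alpha beta j s, \sum_l c l alpha j u * b beta l s u
                         = \sum_l c l alpha s u * b beta l j u.
Proof.
by split=> H alpha beta j s; have := H alpha beta j s;
  rewrite !dcoef0_sum !dcoef0 !partial_cst !addr0.
Qed.

Lemma cst_gram_torsion_compatibility (u : 'rV[R]_N) :
  gram_torsion_compatibility (fun=> B) (fun _ _ (_ : 'I_N) _ => 0) u.
Proof. by move=> alpha beta i; rewrite partial_cst addr0. Qed.

Hypothesis B_unit : B \in unitmx.

(** Right multiplication of row vectors by an invertible matrix is injective. It serves to strip
    [mu] from the Ricci equation. *)
Lemma sum_mulmx_unit (F G : 'I_L -> R) :
  (forall beta, \sum_gamma F gamma * B gamma beta
                = \sum_gamma G gamma * B gamma beta) -> F =1 G.
Proof.
move=> FG; pose rowf (H : 'I_L -> R) := \row_gamma H gamma.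
suff /rowP E : rowf F = rowf G by move=> gamma; have := E gamma; rewrite !mxE.
apply: (can_inj (mulmxK B_unit)); apply/rowP => beta.
rewrite !mxE; under eq_bigr do rewrite mxE; rewrite FG.
by apply: eq_bigr => gamma _; rewrite mxE.
Qed.

End ConstantCoefficients.

(** * Ricci and Gauss equations in terms of [eta] and [mu], the inverses of the Gram matrices *)

Section InverseGramMatrices.
Variables (R : realType) (N L : nat) (eta : 'M[R]_N) (mu : 'M[R]_L).
Hypothesis mu_unit : mu \in unitmx.
Variable omega : 'I_L -> 'I_N -> 'I_N -> 'rV[R]_N -> R.
Let b := bcoef (fun=> invmx mu) omega.
Let c := ccoef (fun=> invmx eta) omega.

Lemma bcoef_invmx beta i j u :
  b beta i j u = \sum_alpha omega alpha i j u * mu alpha beta.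
Proof. by rewrite /b /bcoef invmxK. Qed.

Lemma ccoef_invmx l alpha i u :
  c l alpha i u = - \sum_s eta l s * omega alpha s i u.
Proof. by rewrite /c /ccoef invmxK. Qed.

(** For symmetric [eta] and [omega] the right-hand condition says that the shape operators of any
    two normal directions commute. *)
Lemma ricci_commutation u :
  ricci_equation (fun=> invmx eta) (fun=> invmx mu) omega (fun _ _ _ _ => 0) u
  <-> forall alpha gamma j s,
      \sum_l \sum_t omega alpha t j u * eta l t * omega gamma l s u
      = \sum_l \sum_t omega alpha t s u * eta l t * omega gamma l j u.
Proof.
pose Q alpha j s gamma :=
  \sum_l \sum_t omega alpha t j u * eta l t * omega gamma l s u.
(* The sign comes from [ccoef], the factor [mu] from [bcoef]. *)
have QE alpha beta j s : \sum_l c l alpha j u * b beta l s u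
    = - \sum_gamma Q alpha j s gamma * mu gamma beta.
  rewrite -sumrN; under [RHS]eq_bigr do rewrite -mulNr -sumrN mulr_suml.
  rewrite exchange_big; apply: eq_bigr => l _.
  rewrite bcoef_invmx ccoef_invmx mulr_sumr; apply: eq_bigr => gamma _.
  rewrite mulrA !mulNr; congr (- (_ * _)); rewrite mulr_suml.
  by apply: eq_bigr => t _; rewrite [_ * eta l t]mulrC.
rewrite cst_ricci_equation; split=> H alpha.
  move=> gamma j s.
  apply: (sum_mulmx_unit (F := Q alpha j s) (G := Q alpha s j) mu_unit) => beta.
  by apply: oppr_inj; rewrite -!QE.
move=> beta j s; rewrite !QE; congr (- _); apply: eq_bigr => gamma _.
by rewrite /Q H.
Qed.

(** The index [l] enters both sides only through [eta l t], so it is enough to have the symmetry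
    with the lowered index [t]. *)
Lemma gauss_symmetry u :
  (forall i s t j,
     \sum_gamma (\sum_alpha omega alpha i s u * mu alpha gamma)
                * omega gamma t j u
     = \sum_gamma (\sum_alpha omega alpha i j u * mu alpha gamma)
                  * omega gamma t s u) ->
  gauss_equation (fun=> invmx eta) (fun=> invmx mu) omega u.
Proof.
move=> H; apply/cst_gauss_equation => l i j s.
have E j' s' : \sum_gamma b gamma i s' u * c l gamma j' u
   = - \sum_t eta l t * \sum_gamma
         (\sum_alpha omega alpha i s' u * mu alpha gamma) * omega gamma t j' u.
  under [in RHS]eq_bigr do rewrite mulr_sumr.
  rewrite exchange_big -sumrN; apply: eq_bigr => gamma _.
  rewrite bcoef_invmx ccoef_invmx mulrN mulr_sumr; congr (- _).
  by apply: eq_bigr => t _; rewrite mulrCA.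
by rewrite !E; congr (- _); apply: eq_bigr => t _; rewrite H.
Qed.

End InverseGramMatrices.

(** Constant coefficients reduce the Codazzi equation to the symmetry of the third partials of each
    [psi alpha]. *)
Lemma hessian_codazzi (R : realType) (N L : nat) (A : 'M[R]_N) (B : 'M[R]_L)
    (U : set 'rV[R]_N) (psi : 'I_L -> 'rV[R]_N -> R) u :
  open U -> (forall alpha, smooth_on U (psi alpha)) -> U u ->
  codazzi_equation (fun=> A) (fun=> B)
    (fun alpha i j => partial i (partial j (psi alpha))) (fun _ _ _ _ => 0) u.
Proof.
move=> U_open psi_smooth Uu; apply/cst_codazzi_equation => beta i j s.
have sm alpha i' j' : smooth_on U (partial i' (partial j' (psi alpha))).
  by do 2!apply: smooth_on_partial.
(* Three transpositions: outer [s], [i]; inner [s], [j]; outer [i], [j]. The inner one is needed on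
   all of [U], since it gets differentiated. *)
have E alpha : partial s (partial i (partial j (psi alpha))) u
             = partial j (partial i (partial s (psi alpha))) u.
  have psiC x : U x -> partial s (partial j (psi alpha)) x
                       = partial j (partial s (psi alpha)) x.
    by move=> Ux; exact: (partialC U_open s j (psi_smooth alpha) Ux).
  apply: etrans (partialC U_open s i (smooth_on_partial j (psi_smooth alpha)) Uu) _.
  apply: etrans (eq_partial U_open i psiC Uu) _.
  exact: (partialC U_open i j (smooth_on_partial s (psi_smooth alpha)) Uu).
have df i' j' s' alpha := smooth_on_derivable (i := s') (sm alpha i' j') Uu.
rewrite (partial_lin_comb _ (df i j s)) (partial_lin_comb _ (df i s j)).
by apply: eq_bigr => alpha _; rewrite E.
Qed.

(** * Block decomposition of the normal indices *)

Section BlockIndices.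
Variables (k N p : nat).

(** Quotient and remainder of the index by [N] recover the pair. *)
Lemma block_index_inj :
  injective (fun x : 'I_k * 'I_N => block_index p x.1 x.2).
Proof.
move=> [s m] [t n] /(congr1 val)/= E.
have N0 : (0 < N)%N := leq_ltn_trans (leq0n m) (ltn_ord m).
have st : s = t.
  apply: val_inj => /=; have := congr1 (divn^~ N) E.
  by rewrite !divnMDl// !divn_small// !addn0.
by move: E; rewrite st => /addnI/val_inj ->.
Qed.

Lemma index_cases (alpha : 'I_(k * N + p)) :
  (exists s m, alpha = block_index p s m) \/ exists q, alpha = rshift (k * N) q.
Proof.
case: (splitP alpha) => [x E|q E]; last by right; exists q; apply: val_inj.
(* For [N = 0] the range ['I_(k * N)] of [x] would be empty. *)
have N0 : (0 < N)%N.
  by case: N x {E} => // -[x /=]; rewrite muln0.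
have xk : (x %/ N < k)%N by rewrite ltn_divLR.
left; exists (Ordinal xk), (Ordinal (ltn_pmod x N0)).
by apply: val_inj; rewrite /= -divn_eq.
Qed.

Lemma sum_block (R : nmodType) (F : 'I_(k * N + p) -> R) :
  (forall q, F (rshift (k * N) q) = 0) ->
  \sum_alpha F alpha = \sum_s \sum_m F (block_index p s m).
Proof.
move=> F0; rewrite pair_bigA/=.
rewrite -(big_imset F (A := predT) (in2W block_index_inj)).
rewrite [RHS]big_mkcond; apply: eq_bigr => alpha _.
(* At an [rshift] index both branches of the conditional are 0, so membership in the image need not
   be decided. *)
have [[s [m ->]]|[q ->]] := index_cases alpha; last by rewrite F0 if_same.
rewrite ifT//; apply/imsetP; by exists (s, m).
Qed.

End BlockIndices.

(** * Symmetry of third partial derivatives *)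

Section ThirdPartials.
Variables (R : realType) (N : nat) (U : set 'rV[R]_N).
Hypothesis U_open : open U.
Variable f : 'rV[R]_N -> R.
Hypothesis f_smooth : smooth_on U f.

Lemma partial3C12 i j m u : U u ->
  partial i (partial j (partial m f)) u = partial j (partial i (partial m f)) u.
Proof. exact: (partialC U_open i j (smooth_on_partial m f_smooth)). Qed.

Lemma partial3C23 i j m u : U u ->
  partial i (partial j (partial m f)) u = partial i (partial m (partial j f)) u.
Proof. exact: (eq_partial U_open i (fun x => partialC U_open j m f_smooth)). Qed.

Lemma partial3C13 i j m u : U u ->
  partial i (partial j (partial m f)) u = partial m (partial j (partial i f)) u.
Proof.
move=> Uu; apply: etrans (partial3C12 i j m Uu) _.
by apply: etrans (partial3C23 j i m Uu) _; exact: partial3C12.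
Qed.

End ThirdPartials.

(** * Algebra at one point: [P] models the third partials of the potential, [W] the second
    fundamental forms *)

Section BlockContractions.
Variables (R : realType) (N k p : nat).
Variables (eta : 'M[R]_N) (c : 'M[R]_k) (mu : 'M[R]_(k * N + p)).
Hypothesis eta_sym : eta^T = eta.
Hypothesis mu_block : forall (s t : 'I_k) (m n : 'I_N),
  mu (block_index p s m) (block_index p t n) = c s t * eta m n.
Variable P : 'I_N -> 'I_N -> 'I_N -> R.
Hypothesis PC13 : forall i j m, P i j m = P m j i.
Variable W : 'I_(k * N + p) -> 'I_N -> 'I_N -> R.
Hypothesis W_block : forall s m i j, W (block_index p s m) i j = P i j m.
Hypothesis W_rshift : forall q i j, W (rshift (k * N) q) i j = 0.

(** One side of the associativity equations, which exchange the two middle indices. *)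
Definition assoc_sum i j m n := \sum_a \sum_b P i j a * eta a b * P b m n.

(** A block index contributes its second component as a third differentiation index, so the block
    numbers [s] and [t] drop out. *)
Lemma tangent_contraction s t m n i j :
  \sum_l \sum_a W (block_index p s m) a i * eta l a * W (block_index p t n) l j
  = assoc_sum m i j n.
Proof.
rewrite exchange_big; apply: eq_bigr => a _; apply: eq_bigr => l _.
by rewrite !W_block (PC13 m) -[in LHS]eta_sym mxE.
Qed.

(** Both normal sums reduce to block indices, where [mu] factors. The total of the entries of [c]
    may be 0, so the Gauss equation alone need not give associativity; the converse goes through
    Ricci. *)
Lemma normal_contraction i j a b :
  \sum_gamma (\sum_alpha W alpha i j * mu alpha gamma) * W gamma a b
  = (\sum_s \sum_t c s t) * assoc_sum i j b a.
Proof.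
rewrite sum_block => [|q]; last by rewrite W_rshift mulr0.
transitivity (\sum_t \sum_s c s t * assoc_sum i j b a).
  apply: eq_bigr => t _; under eq_bigr => n _.
    rewrite sum_block => [|q]; last by rewrite W_rshift mul0r.
    rewrite mulr_suml; over.
  rewrite exchange_big; apply: eq_bigr => s _.
  rewrite /assoc_sum [in RHS]exchange_big mulr_sumr; apply: eq_bigr => n _.
  rewrite mulr_suml mulr_sumr; apply: eq_bigr => m _.
  by rewrite !W_block mu_block (PC13 a); ring.
rewrite exchange_big mulr_suml; apply: eq_bigr => s _.
by rewrite mulr_suml.
Qed.

Lemma tangent_contraction_assoc (s : 'I_k) :
  (forall alpha gamma i j,
     \sum_l \sum_a W alpha a i * eta l a * W gamma l j
     = \sum_l \sum_a W alpha a j * eta l a * W gamma l i) ->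
  forall i j m n, assoc_sum i j m n = assoc_sum i m j n.
Proof. by move=> WC i j m n; rewrite -!(tangent_contraction s s) WC. Qed.

Hypothesis P_assoc : forall i j m n, assoc_sum i j m n = assoc_sum i m j n.

Lemma tangent_contractionC alpha gamma i j :
  \sum_l \sum_a W alpha a i * eta l a * W gamma l j
  = \sum_l \sum_a W alpha a j * eta l a * W gamma l i.
Proof.
have [[s [m ->]]|[q ->]] := index_cases alpha; last first.
  by rewrite !big1// => l _; rewrite big1// => a _; rewrite W_rshift !mul0r.
have [[t [n ->]]|[q ->]] := index_cases gamma; last first.
  by rewrite !big1// => l _; rewrite big1// => a _; rewrite W_rshift mulr0.
by rewrite !tangent_contraction.
Qed.

(** Exchanging [j] and [b] exchanges the middle indices of [assoc_sum i j b a]. *)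
Lemma normal_contractionC i j a b :
  \sum_gamma (\sum_alpha W alpha i j * mu alpha gamma) * W gamma a b
  = \sum_gamma (\sum_alpha W alpha i b * mu alpha gamma) * W gamma a j.
Proof. by rewrite !normal_contraction P_assoc. Qed.

End BlockContractions.

(** * Equivalence of the fundamental relations with associativity *)

Theorem theorem5p1 (R : realType) (N k p : nat)
  (N_ge1 : (1 <= N)%N) (k_ge1 : (1 <= k)%N)
  (eta : 'M[R]_N) (c : 'M[R]_k) (mu : 'M[R]_(k * N + p))
  (eta_nondeg : symmetric_nondegenerate eta)
  (c_nondeg : symmetric_nondegenerate c)
  (mu_nondeg : symmetric_nondegenerate mu)
  (mu_block : forall (sigma tau : 'I_k) (m n : 'I_N),
     mu (block_index p sigma m) (block_index p tau n) = c sigma tau * eta m n)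
  (U : set 'rV[R]_N) (U_open : open U)
  (Phi : 'rV[R]_N -> R) (Phi_smooth : smooth_on U Phi)
  (psi : 'I_(k * N + p) -> 'rV[R]_N -> R)
  (psi_grad : forall (sigma : 'I_k) (i : 'I_N) (u : 'rV[R]_N), U u ->
     psi (block_index p sigma i) u = partial i Phi u)
  (psi_linear : forall q : 'I_p, affine_on U (psi (rshift (k * N) q))) :
  let g := fun _ : 'rV[R]_N => invmx eta in
  let h := fun _ : 'rV[R]_N => invmx mu in
  let omega := fun (alpha : 'I_(k * N + p)) (i j : 'I_N) =>
    partial i (partial j (psi alpha)) in
  let kappa := fun (alpha beta : 'I_(k * N + p)) (i : 'I_N)
    (_ : 'rV[R]_N) => 0 in
  admissible g h omega U /\
  (fundamental_relations g h omega kappa U <->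
   associativity_equations eta Phi U).
Proof.
move=> g h omega kappa.
have [eta_sym eta_unit] := eta_nondeg; have [mu_sym mu_unit] := mu_nondeg.
(* Block components agree on [U] with partials of [Phi]; the others are affine. *)
have psi_smooth alpha : smooth_on U (psi alpha).
  have [[s [m ->]]|[q ->]] := index_cases alpha; last exact: affine_smooth_on.
  apply: (eq_smooth_on U_open) (smooth_on_partial m Phi_smooth) => u Uu.
  by rewrite psi_grad.
pose P u i j m := partial i (partial j (partial m Phi)) u.
pose W u alpha i j := omega alpha i j u.
have PC13 u (Uu : U u) i j m : P u i j m = P u m j i.
  exact: (partial3C13 U_open Phi_smooth i j m Uu).
have W_block u (Uu : U u) s m i j : W u (block_index p s m) i j = P u i j m.
  exact: (eq_partial U_open i (eq_partial U_open j (psi_grad s m)) Uu).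
have W_rshift u (Uu : U u) q i j : W u (rshift (k * N) q) i j = 0.
  exact: (affine_on_partial2 U_open i j (psi_linear q) Uu).
split.
  move=> u Uu; split.
  - by split; rewrite /g ?unitmx_inv// trmx_inv eta_sym.
  - by split; rewrite /h ?unitmx_inv// trmx_inv mu_sym.
  - by move=> alpha i j; exact: (partialC U_open i j (psi_smooth alpha) Uu).
split=> [rel u Uu i j m n|assoc u Uu].
  have [_ _ _ /(ricci_commutation eta mu_unit) ricci] := rel u Uu.
  (* [k_ge1] unfolds to [0 < k], so a first block exists; the Ricci equation on it alone yields
     associativity. *)
  pose s0 : 'I_k := Ordinal k_ge1.
  exact: (tangent_contraction_assoc eta_sym (PC13 u Uu) (W_block u Uu) s0 ricci).
split.
- exact: cst_gram_torsion_compatibility.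
- apply: gauss_symmetry => i s t j.
  exact: (normal_contractionC mu_block (PC13 u Uu) (W_block u Uu) (W_rshift u Uu)
    (assoc u Uu)).
- exact: (hessian_codazzi _ _ U_open psi_smooth Uu).
- apply/(ricci_commutation eta mu_unit) => alpha gamma j s.
  exact: (tangent_contractionC eta_sym (PC13 u Uu) (W_block u Uu) (W_rshift u Uu)
    (assoc u Uu)).
Qed.
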